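(* If $A\in\mathbb{R}^{n\times n}$ has $n$ distinct singular values, then $L(O(A))=\{L(B):B\in O(A)\}$ has convex boundary for every linear map $L:\mathbb{R}^{n\times n}\to\mathbb{R}^2$.
   Context: $\mathrm{SO}_n=\{U\in\mathbb{R}^{n\times n}:U^tU=UU^t=I_n,\ \det U>0\}$, and $O(A)=\{UAV:U,V\in\mathrm{SO}_n\}$ for $A\in\mathbb{R}^{n\times n}$. A compact set $M\subseteq\mathbb{R}^2$ is said to have convex boundary if the intersection of $M$ with each of its supporting lines is path connected, where the supporting lines of $M$ are the lines $\{(x,y):\cos\theta\, x+\sin\theta\, y=r_\theta\}$ with $\theta\in[0,2\pi]$ and $r_\theta=\max\{\cos\theta\, x+\sin\theta\, y:(x,y)\in M\}$. *)

(* Defs.v *)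
From mathcomp Require Import all_boot all_order all_algebra.
From mathcomp Require Import all_classical all_reals all_analysis.
Import Order.TTheory GRing.Theory Num.Theory.
Import numFieldNormedType.Exports.

Set Implicit Arguments.
Unset Strict Implicit.
Unset Printing Implicit Defensive.

Local Open Scope classical_set_scope.
Local Open Scope ring_scope.

Definition SO (R : realType) (n : nat) : set 'M[R]_n :=
  [set U | [/\ U^T *m U = 1%:M, U *m U^T = 1%:M & 0 < \det U]].
Arguments SO : clear implicits.

Definition SO_orbit (R : realType) (n : nat) (A : 'M[R]_n) : set 'M[R]_n :=
  [set U *m A *m V | U in SO R n & V in SO R n].

(* As a set: multiplicities are not recorded, so its cardinality is the number
   of distinct singular values. Since A^T *m A is positive semidefinite,
   Num.sqrt is only applied to nonnegative reals. *)
Definition singular_values (R : realType) (n : nat) (A : 'M[R]_n) : set R :=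
  [set Num.sqrt a | a in [set a | eigenvalue (A^T *m A) a]].

Definition path_connected (R : realType) (T : topologicalType) (S : set T) :
    Prop :=
  forall x y, S x -> S y -> exists f : R -> T,
    [/\ {within `[0, 1], continuous f}, f 0 = x, f 1 = y
      & f @` `[0, 1] `<=` S].

(* The plane is 'rV[R]_2; the coordinates (x, y) of p are (p 0 0, p 0 1). *)
Definition dir_form (R : realType) (theta : R) (p : 'rV[R]_2) : R :=
  cos theta * p 0 0 + sin theta * p 0 1.

Definition is_max (R : realType) (E : set R) (r : R) : Prop :=
  E r /\ ubound E r.

Definition supporting_line (R : realType) (M l : set 'rV[R]_2) : Prop :=
  exists theta r : R,
    [/\ 0 <= theta <= 2 * pi, is_max (dir_form theta @` M) r
      & l = [set p | dir_form theta p = r]].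

(* Compactness is included since the notion is only defined for compact sets;
   it guarantees that the maxima defining the supporting lines of a nonempty M
   exist. *)
Definition has_convex_boundary (R : realType) (M : set 'rV[R]_2) : Prop :=
  compact M /\
  forall l, supporting_line M l -> path_connected R (M `&` l).

(* Main.v *)
Require Import Defs.
From HB Require Import structures.
From mathcomp Require Import all_boot all_order all_algebra.
From mathcomp Require Import all_classical all_reals all_analysis.
From mathcomp Require Import fingroup perm ring lra.
Import Order.TTheory GRing.Theory Num.Theory.
Import numFieldNormedType.Exports.

Set Implicit Arguments.
Unset Strict Implicit.
Unset Printing Implicit Defensive.

Local Open Scope classical_set_scope.
Local Open Scope ring_scope.

(** A supporting line of L(O(A)) cuts out the image under L of a face of O(A),
that is, of the set of points where a linear form B |-> tr (P B) is maximal on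
O(A). Since L is continuous, it is enough that the faces of O(A) are path
connected ([SO_orbit_face_path_connected]); compactness is inherited from SO_n.

A can be written U D V with U, V in SO_n and D = diag d, where
d_0 > d_1 > ... > |d_(n-1)|: the last entry carries the sign of det A, and the
inequalities are strict because A has n singular values. Let B = U D V be a
point of a face and put Q = V P U. Maximality of tr (P B) says that
tr (Q X D Y) <= tr (Q D) for all X, Y in SO_n; this relation between Q and D
is called [aligned] below. To first order it says that Q D and D Q are
symmetric, and as the d_i ^ 2 are distinct this forces Q to be diagonal,
Q = diag q ([aligned_diag]). Testing it on quarter turns of the coordinate planes
gives q_0 >= q_1 >= ... >= |q_(n-1)| ([aligned_chamber]). A diagonal matrix of
this shape is determined by its orbit under SO_n x SO_n ([dominant_uniq]), so Q
is the same for all points of the face.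

Consequently, if U' D V' is another point of the face, then W = U^T U' and
Z = V' V^T satisfy Z Q W = Q, and it remains to join (W, Z) to a pair that fixes
D by a path of pairs (g, h) in SO_n x SO_n with h Q g = Q ([stabilizer_path]):
then tr (P U g D h V) = tr (h Q g D) = tr (Q D) stays maximal. The Cayley
transform X |-> (1 - X) (1 + X)^-1, an involution exchanging skew matrices with
orthogonal matrices without eigenvalue -1, turns the equation h Q g = Q into the
linear equation Y Q + Q X = 0, whose solutions can be scaled to 0. The
eigenvalue -1 is avoided by first multiplying W and Z by diagonal sign matrices
E and F ([signs_stabilizer]). Diagonal matrices commute with D, so E and F only
matter through their product E F, which is 1 except where q vanishes and which
has determinant 1. It is a product of half turns fixing Q, which are undone gradually.

The decomposition A = U D V also comes from alignment: a maximum point on O(A)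
of the linear form given by diag (n, ..., 2, 1) must be diagonal
([dominant_svd]). *)

(** * Special orthogonal matrices *)

Section SO.
Context {R : realType} {n : nat}.
Implicit Types U V : 'M[R]_n.

Lemma SO_det1 U : SO R n U -> \det U = 1.
Proof.
case=> U1 _ d; have := congr1 determinant U1.
by rewrite det_mulmx det_tr det1 => dd; nra.
Qed.

Lemma SO_id : SO R n 1%:M.
Proof. by split; rewrite ?trmx1 ?mulmx1 ?det1. Qed.

Lemma SO_tr U : SO R n U -> SO R n U^T.
Proof. by case=> U1 U2 d; split; rewrite ?trmxK ?det_tr. Qed.

Lemma SO_mul U V : SO R n U -> SO R n V -> SO R n (U *m V).
Proof.
case=> U1 U2 dU [V1 V2 dV]; split; last by rewrite det_mulmx mulr_gt0.
  by rewrite trmx_mul mulmxA -(mulmxA _ _ U) U1 mulmx1.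
by rewrite trmx_mul mulmxA -(mulmxA U) V2 mulmx1.
Qed.
End SO.

(** * Continuity of matrix operations and compactness of the orbit *)

Lemma continuous_mx (T U : topologicalType) m n (f : T -> 'M[U]_(m, n)) :
  (forall i j, continuous (fun t => f t i j)) -> continuous f.
Proof.
move=> fc t B [P Pf PB].
pose Q (ij : 'I_m * 'I_n) : set T := [set s | P ij.1 ij.2 (f s ij.1 ij.2)].
have fQ ij : nbhs t (Q ij) by apply: fc; exact: Pf.
have nQ := filter_forall (F := nbhs t) (nbhs_filter t) fQ.
by apply: filterS nQ => s Ps; apply: PB => i j; exact: (Ps (i, j)).
Qed.

Section topology.
Context {R : realType}.
Implicit Types (T : topologicalType).

Lemma continuous_entry T m n (f : T -> 'M[R]_(m, n)) i j :
  continuous f -> continuous (fun t => f t i j).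
Proof.
move=> fc t; apply: (@continuous_comp _ _ _ f (fun M : 'M[R]_(m, n) => M i j)).
  exact: fc.
exact: coord_continuous.
Qed.

Lemma continuous_sum T (I : Type) (r : seq I) (F : I -> T -> R) :
  (forall i, continuous (F i)) -> continuous (fun t => \sum_(i <- r) F i t).
Proof. by move=> Fc; apply: continuous_big => //; exact: add_continuous. Qed.

Lemma continuous_prod T (I : Type) (r : seq I) (F : I -> T -> R) :
  (forall i, continuous (F i)) -> continuous (fun t => \prod_(i <- r) F i t).
Proof. by move=> Fc; apply: continuous_big => //; exact: mul_continuous. Qed.

Lemma continuous_mul T (f g : T -> R) :
  continuous f -> continuous g -> continuous (fun t => f t * g t).
Proof. by move=> fc gc t; apply: (@continuousM R); [exact: fc|exact: gc]. Qed.

Lemma continuous_mulmx T m n p (f : T -> 'M[R]_(m, n)) (g : T -> 'M[R]_(n, p)) :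
  continuous f -> continuous g -> continuous (fun t => f t *m g t).
Proof.
move=> fc gc; apply: continuous_mx => i j; under eq_fun do rewrite mxE.
apply: continuous_sum => k.
by apply: continuous_mul; exact: continuous_entry.
Qed.

Lemma continuous_det T n (f : T -> 'M[R]_n) :
  continuous f -> continuous (fun t => \det (f t)).
Proof.
move=> fc; apply: continuous_sum => s.
apply: continuous_mul; first by move=> ?; exact: cst_continuous.
by apply: continuous_prod => i; exact: continuous_entry.
Qed.

Lemma continuous_invmx T n (f : T -> 'M[R]_n) :
  continuous f -> (forall t, f t \in unitmx) ->
  continuous (fun t => invmx (f t)).
Proof.
move=> fc fu; apply: continuous_mx => i j.
have -> : (fun t => invmx (f t) i j)
    = (fun t => (\det (f t))^-1 * cofactor (f t) j i).
  by apply/funext => t; rewrite /invmx fu !mxE.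
apply: continuous_mul.
  move=> t; apply: (@cvgV R); last exact: continuous_det.
  by have := fu t; rewrite unitmxE unitfE.
apply: continuous_mul; first by move=> ?; exact: cst_continuous.
apply: continuous_det; apply: continuous_mx => k l.
by under eq_fun do rewrite !mxE; exact: continuous_entry.
Qed.

(** In finite dimension a linear map is a finite combination of coordinates. *)
Lemma continuous_linear_mx m n p q (f : {linear 'M[R]_(m, n) -> 'M[R]_(p, q)}) :
  continuous f.
Proof.
apply: continuous_mx => i j.
have -> : (fun M => f M i j) =
    (fun M : 'M[R]_(m, n) => \sum_k \sum_l M k l * f (delta_mx k l) i j).
  apply/funext => M; rewrite [in LHS](matrix_sum_delta M) linear_sum summxE.
  apply: eq_bigr => k _; rewrite linear_sum summxE; apply: eq_bigr => l _.
  by rewrite linearZ mxE.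
apply: continuous_sum => k; apply: continuous_sum => l.
by apply: continuous_mul => ?; [exact: coord_continuous|exact: cst_continuous].
Qed.

(** SO_n is closed, and orthonormality of the columns bounds its entries by 1. *)
Lemma compact_SO n : compact (SO R n).
Proof.
pose box := [set v : 'rV[R]_(n * n) | forall i, `[(-1 : R), 1]%classic (v 0 i)].
have boxc : compact box.
  apply: (@rV_compact R (n * n) (fun=> `[(-1 : R), 1]%classic)) => _.
  exact: segment_compact.
have vc : continuous (vec_mx : 'rV[R]_(n * n) -> 'M[R]_(n, n)).
  exact: continuous_linear_mx.
have cB : compact (vec_mx @` box).
  by apply: continuous_compact => //; exact: continuous_subspaceT.
apply: (subclosed_compact _ cB).
  have -> : SO R n = [set U : 'M[R]_n | U^T *m U = 1%:M] `&`
      [set U | U *m U^T = 1%:M] `&` [set U | \det U = 1].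
    apply/seteqP; split => U /=.
      by move=> HU; split; [case: HU|exact: SO_det1].
    by case=> -[U1 U2 d]; split => //; rewrite d ltr01.
  have idc : continuous (@id 'M[R]_n) by move=> ?; exact: cvg_id.
  have trc : continuous (@trmx R n n) by exact: continuous_linear_mx.
  have clo (f : 'M[R]_n -> 'M[R]_n) (B : 'M[R]_n) : continuous f ->
      closed [set U | f U = B].
    move=> fc; refine (@preimage_closed _ _ f [set B] (fun x _ => fc x) _).
    by apply: accessible_closed_set1; apply: hausdorff_accessible; exact: norm_hausdorff.
  apply: closedI; first apply: closedI.
  - by apply: clo; exact: continuous_mulmx.
  - by apply: clo; exact: continuous_mulmx.
  - have dc := continuous_det idc.
    refine (@preimage_closed _ _ (fun U : 'M[R]_n => \det U) [set 1] (fun x _ => dc x) _).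
    by [].
move=> U [U1 _ _]; exists (mxvec U); last exact: mxvecK.
rewrite /box /= => k; case/mxvec_indexP: k => i j; rewrite mxvecE.
have := congr1 (fun M : 'M[R]_n => M j j) U1; rewrite /= !mxE eqxx => s1.
have : U i j ^+ 2 <= 1.
  rewrite -[leRHS]s1 (bigD1 i)//= !mxE -expr2 lerDl sumr_ge0 // => k _.
  by rewrite !mxE -expr2 sqr_ge0.
by rewrite in_itv /=; move=> ?; apply/andP; split; nra.
Qed.

Lemma compact_SO_orbit n (A : 'M[R]_n) : compact (SO_orbit A).
Proof.
have -> : SO_orbit A = (fun UV => UV.1 *m A *m UV.2) @` (SO R n `*` SO R n).
  apply/seteqP; split=> M.
    by case=> U HU [V HV <-]; exists (U, V).
  by case=> -[U V] [/= HU HV] <-; exists U => //; exists V.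
apply: continuous_compact; last by apply: compact_setX; exact: compact_SO.
apply: continuous_subspaceT; apply: continuous_mulmx; last by move=> ?; exact: cvg_snd.
apply: continuous_mulmx; first by move=> ?; exact: cvg_fst.
by move=> ?; exact: cst_continuous.
Qed.
End topology.

(** * The Cayley transform *)

(** Locked, so that rewriting with associativity does not open the product. *)
HB.lock Definition cayley (R : realType) n (X : 'M[R]_n) : 'M[R]_n :=
  (1%:M - X) *m invmx (1%:M + X).

Section cayley.
Context {R : realType}.

Lemma mulmx_tr_eq0 m n (A : 'M[R]_(m, n)) : A *m A^T = 0 -> A = 0.
Proof.
move=> A0; apply/matrixP => i j; rewrite mxE.
have /eqP := congr1 (fun M : 'M[R]_m => M i i) A0; rewrite /= !mxE.
rewrite psumr_eq0 => [/allP /(_ j)|k _]; last by rewrite mxE -expr2 sqr_ge0.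
by rewrite mem_index_enum mxE /= -expr2 sqrf_eq0 => /(_ isT) /eqP.
Qed.

Context {n : nat}.
Implicit Types X Y Q M J P : 'M[R]_n.

(** If v X = - v then v v^T = - v X v^T, and v X v^T vanishes as X is skew. *)
Lemma unitmx_skew X : X^T = - X -> 1%:M + X \in unitmx.
Proof.
move=> Xs; rewrite -row_free_unit; apply: inj_row_free => v.
rewrite mulmxDr mulmx1 => /eqP; rewrite addr_eq0 => /eqP vX.
apply: mulmx_tr_eq0.
have vv : v *m v^T = - (v *m X *m v^T) by rewrite {1}vX mulNmx.
have : (v *m v^T)^T = - (v *m v^T).
  rewrite [in LHS]vv linearN/= !trmx_mul trmxK Xs mulNmx mulmxN mulmxA.
  by rewrite vv.
rewrite trmx_mul trmxK => /eqP; rewrite -addr_eq0 -mulr2n -scaler_nat scaler_eq0.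
by rewrite pnatr_eq0 => /eqP.
Qed.

Lemma mulmx_cayley X : 1%:M + X \in unitmx -> cayley X *m (1%:M + X) = 1%:M - X.
Proof. by move=> Xu; rewrite cayley.unlock mulmxKV. Qed.

Lemma comm_1DB X : (1%:M + X) *m (1%:M - X) = (1%:M - X) *m (1%:M + X).
Proof.
by rewrite mulmxBr mulmxBl !mulmxDl !mulmxDr !mul1mx !mulmx1.
Qed.

Lemma cayleyC X : 1%:M + X \in unitmx ->
  cayley X = invmx (1%:M + X) *m (1%:M - X).
Proof.
move=> Xu; apply: (can_inj (mulKmx Xu)).
by rewrite mulKVmx// cayley.unlock mulmxA comm_1DB mulmxK.
Qed.

Lemma cayley_mulmx X : 1%:M + X \in unitmx -> (1%:M + X) *m cayley X = 1%:M - X.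
Proof. by move=> Xu; rewrite cayleyC// mulKVmx. Qed.

Lemma cayley_eq X Q : 1%:M + X \in unitmx -> Q *m (1%:M + X) = 1%:M - X ->
  cayley X = Q.
Proof. by move=> Xu QX; rewrite cayley.unlock -QX mulmxK. Qed.

Lemma cayley0 : cayley (0 : 'M[R]_n) = 1%:M.
Proof. by rewrite cayley.unlock subr0 addr0 invmx1 mulmx1. Qed.

Lemma cayley_SO X : X^T = - X -> SO R n (cayley X).
Proof.
move=> Xs; have Xu := unitmx_skew Xs.
have Xu' : 1%:M - X \in unitmx by rewrite -Xs -(trmx1 R n) -linearD/= unitmx_tr.
have tE : (cayley X)^T = invmx (1%:M - X) *m (1%:M + X).
  by rewrite cayley.unlock trmx_mul trmx_inv linearD linearB/= trmx1 Xs opprK.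
have U1 : (cayley X)^T *m cayley X = 1%:M.
  rewrite tE cayley.unlock mulmxA -(mulmxA (invmx (1%:M - X))) comm_1DB.
  by rewrite mulmxA mulVmx// mul1mx mulmxV.
split=> //; first exact: mulmx1C.
rewrite cayley.unlock det_mulmx det_inv -(det_tr (1%:M - X)) linearB/= trmx1 Xs opprK.
by rewrite divff ?ltr01// -unitfE -unitmxE.
Qed.

(** The Cayley transform is an involution, so a rotation without eigenvalue -1 is
the transform of a skew matrix and is joined to 1 by scaling that matrix. *)
Lemma cayley_ortho Q : Q^T *m Q = 1%:M -> 1%:M + Q \in unitmx ->
  (cayley Q)^T = - cayley Q /\ cayley (cayley Q) = Q.
Proof.
move=> Q1 Qu; have Xs : (cayley Q)^T = - cayley Q.
  have Qu' : 1%:M + Q^T \in unitmx.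
    by rewrite -(trmx1 R n) -linearD/= unitmx_tr.
  rewrite {1}cayley.unlock trmx_mul trmx_inv linearD linearB/= trmx1.
  apply: (can_inj (mulKmx Qu')); rewrite mulKVmx// mulmxN.
  apply: (can_inj (mulmxK Qu)); rewrite mulNmx -mulmxA mulmx_cayley//.
  rewrite mulmxBl mulmxBr !mulmxDr !mulmxDl !mul1mx !mulmx1 Q1.
  by apply/matrixP => i j; rewrite !mxE; ring.
split=> //; apply: cayley_eq; first exact: unitmx_skew.
rewrite mulmxDr mulmx1.
apply: (can_inj (mulmxK Qu)).
rewrite mulmxDl mulmxBl -mulmxA mulmx_cayley// mulmxBr mulmxDr !mulmx1 mul1mx.
by apply/matrixP => i j; rewrite !mxE; ring.
Qed.

(** With h = cayley Y and g = cayley X, the equation h Q g = Q is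
(1 - Y) Q (1 - X) = (1 + Y) Q (1 + X), whose even terms cancel. *)
Lemma cayley_intertwine X Y Q : 1%:M + X \in unitmx -> 1%:M + Y \in unitmx ->
  Y *m Q + Q *m X = 0 -> cayley Y *m Q *m cayley X = Q.
Proof.
move=> Xu Yu YX; apply: (can_inj (mulKmx Yu)); apply: (can_inj (mulmxK Xu)).
rewrite !mulmxA cayley_mulmx// -(mulmxA _ (cayley X)) mulmx_cayley//.
rewrite !mulmxDr !mulmx1 !mulmxDl !(mulNmx, mulmxN) !mul1mx.
have -> : Q *m X = - (Y *m Q) by apply/eqP; rewrite -addr_eq0 addrC YX.
move: (Y *m Q *m X) => YQX.
by apply/matrixP => i j; rewrite !mxE; ring.
Qed.

Lemma intertwine_cayley X Y Q : 1%:M + X \in unitmx -> 1%:M + Y \in unitmx ->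
  Y *m Q *m X = Q -> cayley Y *m Q + Q *m cayley X = 0.
Proof.
move=> Xu Yu YQX; apply: (can_inj (mulKmx Yu)); apply: (can_inj (mulmxK Xu)).
rewrite (mulmxDr (1%:M + Y)) mulmxA cayley_mulmx// mulmx0 mul0mx (mulmxDl _ _ (1%:M + X)).
rewrite -(mulmxA (1%:M + Y)) -(mulmxA Q) mulmx_cayley// mulmxA.
rewrite !mulmxDr !mulmx1 !mulmxDl !(mulNmx, mulmxN) !mul1mx YQX.
by apply/matrixP => i j; rewrite !mxE; ring.
Qed.

(** This is the rotation by the angle -2 arctan t in the planes that J turns: it
follows because J ^ 2 = - P reduces 1 + t J to a complex number. *)
Lemma cayley_complex_structure J P (t : R) :
  J^T = - J -> J *m J = - P -> P *m J = J ->
  cayley (t *: J) =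
    1%:M - (2 * t ^+ 2 / (1 + t ^+ 2)) *: P - (2 * t / (1 + t ^+ 2)) *: J.
Proof.
move=> Js J2 PJ; apply: cayley_eq.
  by apply: unitmx_skew; rewrite linearZ/= Js scalerN.
rewrite mulmxDr mulmx1 2!mulmxBl mul1mx -!scalemxAl -!scalemxAr J2 PJ.
have t0 : 1 + t ^+ 2 != 0 by rewrite gt_eqF// ltr_wpDr ?sqr_ge0.
by apply/matrixP => i j; rewrite !mxE; field.
Qed.
End cayley.

(** * Rotations of coordinate planes *)

Section planes.
Context {R : realType} {n : nat}.
Implicit Types (i j : 'I_n) (S T : {set 'I_n}) (N Q D J K : 'M[R]_n) (d q : 'rV[R]_n).

Definition coord_proj S : 'M[R]_n := diag_mx (\row_k (k \in S)%:R).

(** J is a quarter turn of the span of the coordinates in S, and 0 on the others. *)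
Definition complex_structure S J :=
  [/\ J^T = - J, J *m J = - coord_proj S & coord_proj S *m J = J].

Definition plane_mx i j : 'M[R]_n := delta_mx i j - delta_mx j i.

Lemma complex_structureC S J : complex_structure S J -> J *m coord_proj S = J.
Proof.
case=> Js _ PJ; apply: trmx_inj.
by rewrite trmx_mul tr_diag_mx Js mulmxN PJ.
Qed.

Lemma coord_proj2 i j : i != j ->
  coord_proj [set i; j] = delta_mx i i + delta_mx j j.
Proof.
move=> ij; apply/matrixP => k l; rewrite !mxE !inE.
have [->|kl] := eqVneq k l.
  rewrite mulr1n !andbb; have [->|] := eqVneq l i; last by rewrite add0r.
  by rewrite (negbTE ij) addr0.
have e x : (k == x) && (l == x) = false.
  by apply/negbTE; apply: contra kl => /andP[/eqP-> /eqP->].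
by rewrite mulr0n !e addr0.
Qed.

Lemma plane_complex_structure i j : i != j ->
  complex_structure [set i; j] (plane_mx i j).
Proof.
move=> ij; have ji : j != i by rewrite eq_sym.
split.
- by rewrite linearB/= !trmx_delta opprB.
- rewrite coord_proj2// mulmxBr !mulmxBl !mul_delta_mx !mul_delta_mx_0//.
  by rewrite sub0r subr0 opprD addrC.
- rewrite coord_proj2// mulmxDl !mulmxBr !mul_delta_mx !mul_delta_mx_0//.
  by rewrite sub0r subr0.
Qed.

Lemma coord_proj_disjoint S T : {in S, forall k, k \notin T} ->
  coord_proj S *m coord_proj T = 0.
Proof.
move=> ST; rewrite /coord_proj mulmx_diag; apply/matrixP => k l; rewrite !mxE.
rewrite -natrM mulnb; case: (boolP (k \in S)) => kS; rewrite /= ?mul0rn//.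
by rewrite (negbTE (ST _ kS)) mul0rn.
Qed.

Lemma coord_projU S T : {in S, forall k, k \notin T} ->
  coord_proj (S :|: T) = coord_proj S + coord_proj T.
Proof.
move=> ST; rewrite -linearD/=; congr diag_mx.
apply/rowP => k; rewrite !mxE inE -natrD; congr (_%:R).
by case: (boolP (k \in S)) => kS //=; rewrite (negbTE (ST _ kS)).
Qed.

Lemma complex_structureU S T J K : {in S, forall k, k \notin T} ->
  complex_structure S J -> complex_structure T K ->
  complex_structure (S :|: T) (J + K).
Proof.
move=> ST cJ cK; have JP := complex_structureC cJ; have KP := complex_structureC cK.
have TS : {in T, forall k, k \notin S}.
  by move=> k; apply: contraTN => /ST.
case: cJ cK => Js J2 PJ [Ks K2 PK].
have JK : J *m K = 0.
  by rewrite -JP -PK mulmxA -(mulmxA J) coord_proj_disjoint// mulmx0 mul0mx.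
have KJ : K *m J = 0.
  by rewrite -KP -PJ mulmxA -(mulmxA K) coord_proj_disjoint// mulmx0 mul0mx.
have PSK : coord_proj S *m K = 0.
  by rewrite -PK mulmxA coord_proj_disjoint// mul0mx.
have PTJ : coord_proj T *m J = 0.
  by rewrite -PJ mulmxA coord_proj_disjoint// mul0mx.
split; rewrite ?coord_projU//.
- by rewrite linearD/= Js Ks opprD.
- by rewrite mulmxDl !mulmxDr JK KJ J2 K2 addr0 add0r opprD.
- by rewrite mulmxDl !mulmxDr PSK PTJ PJ PK addr0 add0r.
Qed.

(** The coordinates in S are paired up, and each pair spans a plane to turn. *)
Lemma complex_structure_even S : ~~ odd #|S| -> exists J, complex_structure S J.
Proof.
have [k] := ubnP #|S|; elim: k S => // k IHk S Sk Se.
have [->|[i iS]] := set_0Vmem S.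
  exists 0; split; rewrite ?trmx0 ?mulmx0 ?oppr0//.
  apply/esym/eqP; rewrite oppr_eq0; apply/eqP/matrixP => a b.
  by rewrite !mxE inE mul0rn.
have [Si0|[j]] := set_0Vmem (S :\ i).
  by move: Se; rewrite (cardsD1 i) iS Si0 cards0.
rewrite !inE => /andP[ji jS].
have ij : i != j by rewrite eq_sym.
have subS : [set i; j]%SET \subset S.
  by rewrite finset.subUset !finset.sub1set iS jS.
have cS : #|S| = #|S :\: [set i; j]%SET|.+2.
  by rewrite -(cardsID [set i; j]%SET S) (finset.setIidPr subS) cards2 ij.
have [J cJ] : exists J, complex_structure (S :\: [set i; j]%SET) J.
  apply: IHk; first by move: Sk; rewrite cS ltnS => /ltnW.
  by move: Se; rewrite cS /= negbK.
exists (plane_mx i j + J).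
have -> : S = [set i; j]%SET :|: (S :\: [set i; j]%SET).
  by rewrite -{1}(finset.setID S [set i; j]%SET) (finset.setIidPr subS).
apply: complex_structureU => //; last exact: plane_complex_structure.
by move=> l; rewrite !inE => ->.
Qed.

Lemma mxtrace_mul_delta N i j : \tr (N *m delta_mx i j) = N j i.
Proof.
rewrite /mxtrace (bigD1 j)//= big1 ?addr0 => [|k kj].
  rewrite !mxE (bigD1 i)//= big1 ?addr0 => [|k ki].
    by rewrite mxE !eqxx mulr1.
  by rewrite mxE (negbTE ki) mulr0.
by rewrite mxE big1// => l _; rewrite mxE (negbTE kj) andbF mulr0.
Qed.

Lemma delta_mul_diag i j d :
  delta_mx i j *m diag_mx d = d 0 j *: delta_mx i j.
Proof.
apply/matrixP => k l; rewrite mul_mx_diag !mxE mulrC.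
by have [->//|] := eqVneq l j; rewrite andbF !mulr0.
Qed.

End planes.

(** * Maxima of linear forms on an orbit *)

Section optimal.
Context {R : realType} {n : nat}.
Implicit Types (i j : 'I_n) (N Q D J : 'M[R]_n) (d q : 'rV[R]_n).

(** The derivative at 1 of U |-> tr (N U) along a rotation of the plane (i, j) is
a multiple of N j i - N i j. The rotations are taken as Cayley transforms, so
that maximality is an inequality between rational functions of t. *)
Lemma SO_trace_max_sym N :
  (forall U, SO R n U -> \tr (N *m U) <= \tr N) -> N^T = N.
Proof.
move=> Nmax; apply/matrixP => i j; rewrite mxE.
have [->//|ij] := eqVneq i j.
have [Js J2 PJ] := plane_complex_structure (R := R) ij.
set J := plane_mx i j in Js J2 PJ; set P := coord_proj _ in J2 PJ.
pose al := \tr (N *m P); pose be := \tr (N *m J).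
have beE : be = N j i - N i j.
  by rewrite /be /J mulmxBr linearB/= !mxtrace_mul_delta.
have quad t : 0 <= t ^+ 2 * al + t * be.
  have tJ : (t *: J)^T = - (t *: J) by rewrite linearZ/= Js scalerN.
  have := Nmax _ (cayley_SO tJ).
  rewrite (cayley_complex_structure _ Js J2 PJ) mulmxBr mulmxBr mulmx1.
  rewrite -2!scalemxAr 2!raddfB/= 2!mxtraceZ -/al -/be.
  have t0 : 0 < 1 + t ^+ 2 by rewrite ltr_wpDr ?sqr_ge0.
  rewrite -addrA gerDl -opprD oppr_le0.
  have -> : 2 * t ^+ 2 / (1 + t ^+ 2) * al + 2 * t / (1 + t ^+ 2) * be
     = (t ^+ 2 * al + t * be) * (2 / (1 + t ^+ 2)) by field; rewrite gt_eqF.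
  by rewrite pmulr_lge0// divr_gt0.
apply/eqP; rewrite -subr_eq0 -beE; apply: contraT => be0.
pose c := 1 + `|al|.
have c0 : 0 < c by rewrite ltr_wpDr.
(* a value of t at which the linear term be dominates the quadratic term al *)
have := quad (- be / c).
have -> : (- be / c) ^+ 2 * al + - be / c * be = (be / c) ^+ 2 * (al - c).
  by field; rewrite gt_eqF.
rewrite pmulr_rge0 ?exprn_even_gt0//= ?mulf_neq0// ?invr_neq0 ?gt_eqF//.
by rewrite subr_ge0 /c; have := ler_norm al; lra.
Qed.

(** D maximizes the linear form given by Q on its orbit. The relation is symmetric
in Q and D. *)
Definition aligned Q D := forall U V, SO R n U -> SO R n V ->
  \tr (Q *m (U *m D *m V)) <= \tr (Q *m D).

Lemma alignedC Q D : aligned Q D -> aligned D Q.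
Proof.
move=> QD U V HU HV.
have -> : \tr (D *m (U *m Q *m V)) = \tr (Q *m (V *m D *m U)).
  by rewrite -mulmxA mulmxA mxtrace_mulC !mulmxA.
by rewrite (mxtrace_mulC D); exact: QD.
Qed.

Lemma aligned_sym Q D : aligned Q D -> (Q *m D)^T = Q *m D.
Proof.
move=> QD; apply: SO_trace_max_sym => U HU.
by have := QD _ _ SO_id HU; rewrite mul1mx mulmxA.
Qed.

(** Symmetry of Q D and of D Q gives Q i j * d_j = Q j i * d_i and
d_i * Q i j = d_j * Q j i, hence Q i j * d_i ^ 2 = Q i j * d_j ^ 2. *)
Lemma aligned_diag Q d : (forall i j, i != j -> d 0 i ^+ 2 != d 0 j ^+ 2) ->
  aligned Q (diag_mx d) -> exists q, Q = diag_mx q.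
Proof.
move=> dd QD.
have S1 := aligned_sym QD; have S2 := aligned_sym (alignedC QD).
apply/diag_mxP/is_diag_mxP => i j ij.
have := congr1 (fun M : 'M[R]_n => M j i) S1; rewrite mul_mx_diag !mxE => e1.
have := congr1 (fun M : 'M[R]_n => M j i) S2; rewrite mul_diag_mx !mxE => e2.
have : Q i j * (d 0 i ^+ 2 - d 0 j ^+ 2) = 0.
  have -> : Q i j * (d 0 i ^+ 2 - d 0 j ^+ 2) =
    d 0 i * (d 0 i * Q i j) - d 0 j * (Q i j * d 0 j) by ring.
  by rewrite e1 e2; ring.
by move/eqP; rewrite mulf_eq0 subr_eq0 (negbTE (dd _ _ ij)) orbF => /eqP.
Qed.

(** Conjugating D by a quarter turn of the plane (i, j) swaps d_i and d_j;
multiplying D on both sides by the same quarter turn swaps and negates them. *)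
Lemma aligned_chamber q d i j : i != j -> aligned (diag_mx q) (diag_mx d) ->
  0 <= (q 0 i - q 0 j) * (d 0 i - d 0 j) /\ 0 <= (q 0 i + q 0 j) * (d 0 i + d 0 j).
Proof.
move=> ij QD; have ji : j != i by rewrite eq_sym.
set P : 'M[R]_n := coord_proj [set i; j]%SET.
(* J is kept abstract: distributivity would split plane_mx into two terms *)
have [J [Js J2 PJ JP JDJ]] : exists J, [/\ J^T = - J, J *m J = - P, P *m J = J,
    J *m P = J & J *m diag_mx d *m J
      = - (d 0 j *: delta_mx i i + d 0 i *: delta_mx j j)].
  have cJ := plane_complex_structure (R := R) ij.
  have JP := complex_structureC cJ; case: cJ => Js J2 PJ.
  exists (plane_mx i j); split=> //.
  rewrite mulmxBl !delta_mul_diag mulmxBr !mulmxBl -!scalemxAl.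
  rewrite !mul_delta_mx !mul_delta_mx_0// !scaler0.
  by rewrite sub0r subr0 opprD addrC.
have cE (s : bool) : cayley ((-1) ^+ s *: J) = 1%:M - P - (-1) ^+ s *: J.
  rewrite (cayley_complex_structure _ Js J2 PJ) sqrr_sign.
  have -> : 2 * 1 / (1 + 1) = 1 :> R by field.
  have -> : 2 * (-1) ^+ s / (1 + 1) = (-1) ^+ s :> R by field.
  by rewrite scale1r.
have cS (s : bool) : SO R n (cayley ((-1) ^+ s *: J)).
  by apply: cayley_SO; rewrite linearZ/= Js scalerN.
have main (s : bool) : cayley ((-1) ^+ false *: J) *m diag_mx d *m cayley ((-1) ^+ s *: J)
   = diag_mx d - diag_mx d *m P
     - (-1) ^+ s *: (d 0 j *: delta_mx i i + d 0 i *: delta_mx j j).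
  have DP : diag_mx d *m P = P *m diag_mx d by rewrite diag_mxC.
  have PP : P *m P = P by apply: oppr_inj; rewrite -mulmxN -J2 mulmxA PJ J2.
  have JD : J *m diag_mx d *m P = J *m diag_mx d.
    by rewrite -mulmxA DP mulmxA JP.
  have PD : P *m diag_mx d *m J = diag_mx d *m J by rewrite -DP -mulmxA PJ.
  rewrite !cE expr0 scale1r !mulmxBl !mulmxBr !mul1mx !mulmx1 -!scalemxAr.
  rewrite JDJ JD PD -DP -mulmxA PP.
  by apply/matrixP => a b; rewrite !mxE; ring.
have trE (s : bool) :
  \tr (diag_mx q *m (cayley ((-1) ^+ false *: J) *m diag_mx d *m
                     cayley ((-1) ^+ s *: J)))
  = \tr (diag_mx q *m diag_mx d) - (q 0 i * d 0 i + q 0 j * d 0 j)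
    - (-1) ^+ s * (q 0 i * d 0 j + q 0 j * d 0 i).
  rewrite main mulmxBr mulmxBr -scalemxAr 2!raddfB/= mxtraceZ.
  rewrite /P coord_proj2// mulmxA mulmxDr mxtraceD 2!mxtrace_mul_delta.
  rewrite mulmxDr -2!scalemxAr mxtraceD 2!mxtraceZ 2!mxtrace_mul_delta.
  by rewrite mulmx_diag !mxE !eqxx !mulr1n; ring.
split.
  have := QD _ _ (cS false) (cS true); rewrite trE expr1.
  by rewrite -subr_ge0; congr (0 <= _); ring.
have := QD _ _ (cS false) (cS false); rewrite trE expr0.
by rewrite -subr_ge0; congr (0 <= _); ring.
Qed.

End optimal.

(** * Avoiding the eigenvalue -1 *)

Section signs.
Context {R : realType} {n : nat}.
Implicit Types (M W Z U V X Y : 'M[R]_n) (q d e x : 'rV[R]_n).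

Definition signs e := forall i, e 0 i ^+ 2 = 1.

Lemma signsP e i : signs e -> e 0 i = 1 \/ e 0 i = -1.
Proof. by move=> /(_ i)/eqP; rewrite sqrf_eq1 => /orP [/eqP|/eqP]; [left|right]. Qed.

Lemma signs_sq e : signs e -> diag_mx e *m diag_mx e = 1%:M.
Proof.
move=> es; rewrite mulmx_diag -diag_const_mx; congr diag_mx.
by apply/rowP => i; rewrite !mxE -expr2 es.
Qed.

(** The determinant is affine in each diagonal entry, hence interpolated from the
values of that entry at 1 and -1. *)
Lemma det_add_diag_upd x M i :
  let upd c := \row_k (if k == i then c else x 0 k) in
  \det (diag_mx x + M) =
    (1 + x 0 i) / 2 * \det (diag_mx (upd 1) + M)
    + (1 - x 0 i) / 2 * \det (diag_mx (upd (-1)) + M).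
Proof.
move=> upd; apply: (@determinant_multilinear _ _ _ _ _ i).
- apply/rowP => k; rewrite !mxE eqxx.
  by case: (i == k); rewrite ?mulr1n ?mulr0n; field.
- apply/matrixP => k l; rewrite !mxE; congr (_ *+ _ + _).
  by rewrite eq_sym (negbTE (neq_lift i k)).
- apply/matrixP => k l; rewrite !mxE; congr (_ *+ _ + _).
  by rewrite eq_sym (negbTE (neq_lift i k)).
Qed.

(** The entries of x other than 1 and -1 are replaced by signs one at a time: an
affine function that does not vanish at x_i cannot vanish at both 1 and -1. *)
Lemma signs_unitmx x M : diag_mx x + M \in unitmx ->
  exists e, [/\ signs e, forall i, x 0 i ^+ 2 = 1 -> e 0 i = x 0 i
    & diag_mx e + M \in unitmx].
Proof.
have [k] := ubnP #|[pred i | x 0 i ^+ 2 != 1]|.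
elim: k x => // k IHk x xk xu.
have [i xi|x1] := pickP [pred i | x 0 i ^+ 2 != 1]; last first.
  by exists x; split=> // i; apply/eqP; have /negbT := x1 i; rewrite negbK.
pose upd c := \row_k (if k == i then c else x 0 k).
have [c c1 cu] : exists2 c, c ^+ 2 = 1 & diag_mx (upd c) + M \in unitmx.
  have := xu; rewrite unitmxE unitfE (det_add_diag_upd x M i).
  have [d1|d1] := eqVneq (\det (diag_mx (upd 1) + M)) 0; last first.
    by exists 1; rewrite ?expr1n// unitmxE unitfE.
  rewrite d1 mulr0 add0r mulf_eq0 negb_or => /andP[_ dN].
  by exists (-1); rewrite ?sqrrN ?expr1n// unitmxE unitfE.
have updi l : x 0 l ^+ 2 = 1 -> upd c 0 l = x 0 l.
  rewrite mxE; case: eqP => [->|//] xi1.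
  by move: xi; rewrite /= xi1 eqxx.
have [|e [es ex eu]] := IHk _ _ cu.
  rewrite -ltnS; apply: leq_trans xk; rewrite ltnS; apply: proper_card.
  apply/properP; split; last by exists i; rewrite ?inE// mxE eqxx c1 eqxx.
  apply/fintype.subsetP => l; rewrite !inE; apply: contraNN => /eqP xl.
  by rewrite updi// xl.
by exists e; split=> // l xl; rewrite -(updi l)// ex// updi.
Qed.

(** If v x = - v Z then v and v x have the same length, although x shortens no
coordinate and lengthens those with x_i ^ 2 <> 1. *)
Lemma diag_add_ortho_ker x Z (v : 'rV[R]_n) : Z *m Z^T = 1%:M ->
  (forall i, 1 <= x 0 i ^+ 2) -> v *m (diag_mx x + Z) = 0 ->
  forall i, x 0 i ^+ 2 != 1 -> v 0 i = 0.
Proof.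
move=> Z1 x1; rewrite mulmxDr => /eqP; rewrite addr_eq0 => /eqP vx i xi.
have : (v *m diag_mx x) *m (v *m diag_mx x)^T = v *m v^T.
  rewrite vx linearN/= mulmxN mulNmx opprK trmx_mul mulmxA -(mulmxA v) Z1.
  by rewrite mulmx1.
move=> /(congr1 (fun M : 'M[R]_1 => M 0 0))/eqP; rewrite /= -subr_eq0 mul_mx_diag !mxE.
rewrite -sumrB psumr_eq0 => [/allP /(_ i)|k _]; rewrite !mxE; last first.
  have -> : v 0 k * x 0 k * (v 0 k * x 0 k) - v 0 k * v 0 k
    = v 0 k ^+ 2 * (x 0 k ^+ 2 - 1) by ring.
  by rewrite mulr_ge0 ?sqr_ge0// subr_ge0.
have -> : v 0 i * x 0 i * (v 0 i * x 0 i) - v 0 i * v 0 i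
    = v 0 i ^+ 2 * (x 0 i ^+ 2 - 1) by ring.
rewrite mem_index_enum /= mulf_eq0 subr_eq0 (negbTE xi) orbF sqrf_eq0.
by move=> /(_ isT)/eqP.
Qed.

(** The signs e exist because 2 + W is invertible. For f, one starts from the entries
e_i where q_i <> 0 and 2 elsewhere. A kernel vector v is supported where q does
not vanish, and there Z acts as W^T up to conjugation by Q, so that v comes from
a kernel vector of W^T + diag e. The subsequent choice of signs does not touch
the entries that already are signs. *)
Lemma signs_stabilizer W Z q : SO R n W -> SO R n Z ->
  Z *m diag_mx q *m W = diag_mx q ->
  exists e f, [/\ signs e, signs f, forall i, q 0 i != 0 -> f 0 i = e 0 i,
    diag_mx e + W \in unitmx & diag_mx f + Z \in unitmx].
Proof.
move=> [W1 W2 _] [Z1 Z2 _] ZQW; set Q := diag_mx q in ZQW *.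
have two : (2 : R) ^+ 2 != 1.
  by rewrite gt_eqF//; lra.
have [e [es _ eu]] : exists e, [/\ signs e,
    forall i, (const_mx 2 : 'rV[R]_n) 0 i ^+ 2 = 1 -> e 0 i = (const_mx 2 : 'rV[R]_n) 0 i
    & diag_mx e + W \in unitmx].
  apply: signs_unitmx; rewrite -row_free_unit; apply: inj_row_free => v v0.
  apply/rowP => i; rewrite [RHS]mxE; apply: (diag_add_ortho_ker W2 _ v0).
    by move=> k; rewrite mxE; lra.
  by rewrite mxE.
pose x := \row_i (if q 0 i == 0 then 2 else e 0 i).
have ZQ : Z *m Q = Q *m W^T.
  by rewrite -[in RHS]ZQW -mulmxA W2 mulmx1.
have QZ : Q *m Z = W^T *m Q.
  have := congr1 trmx ZQW; rewrite !trmx_mul tr_diag_mx -/Q => e1.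
  by rewrite -[in LHS]e1 -!mulmxA Z1 mulmx1.
have QQW : Q *m Q *m W^T = W^T *m (Q *m Q).
  by rewrite -mulmxA -ZQ mulmxA QZ mulmxA.
have xu : diag_mx x + Z \in unitmx.
  rewrite -row_free_unit; apply: inj_row_free => v v0.
  have vq i : q 0 i = 0 -> v 0 i = 0.
    move=> qi; apply: (diag_add_ortho_ker Z2 _ v0).
      by move=> k; rewrite mxE; case: ifP => _; [lra|rewrite es].
    by rewrite mxE qi eqxx.
  (* Q is needed once for Q Z = W^T Q and twice for Q Q W^T = W^T Q Q *)
  pose u := \row_i (v 0 i / q 0 i ^+ 3).
  have vE : v = u *m (Q *m Q) *m Q.
    apply/rowP => i; rewrite mulmx_diag !mul_mx_diag !mxE.
    have [qi|qi] := eqVneq (q 0 i) 0; first by rewrite vq// qi !mulr0.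
    by field.
  have xE : Q *m diag_mx x = diag_mx e *m Q.
    rewrite diag_mxC !mulmx_diag; congr diag_mx; apply/rowP => i; rewrite !mxE.
    by case: eqP => [->|//]; rewrite !mulr0.
  have uW : u *m (W^T + diag_mx e) *m (Q *m Q) *m Q = 0.
    have vX : v *m diag_mx x = u *m diag_mx e *m (Q *m Q) *m Q.
      rewrite vE -!(mulmxA u) -(mulmxA _ Q (diag_mx x)) xE [Q *m Q]mulmx_diag.
      by rewrite [in LHS]mulmxA [in LHS]diag_mxC mulmxA.
    have vZ : v *m Z = u *m W^T *m (Q *m Q) *m Q.
      by rewrite [in LHS]vE -[LHS]mulmxA QZ [LHS]mulmxA -(mulmxA u (Q *m Q)) QQW !mulmxA.
    by rewrite mulmxDr 2!mulmxDl -vX -vZ addrC -mulmxDr v0.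
  have uWE : u *m (Q *m Q) *m (W^T + diag_mx e) = 0.
    have -> : u *m (Q *m Q) *m (W^T + diag_mx e) = u *m (W^T + diag_mx e) *m (Q *m Q).
      rewrite -(mulmxA u) -[RHS](mulmxA u); congr (_ *m _).
      by rewrite mulmxDl mulmxDr QQW [Q *m Q]mulmx_diag diag_mxC.
    move: uW; move: (u *m _) => w /rowP wQ; apply/rowP => i.
    have := wQ i; rewrite mulmx_diag !mul_mx_diag !mxE.
    move=> /eqP; rewrite !mulf_eq0 !orbb -orbA orbb => wq.
    by apply/eqP; rewrite !mulf_eq0 orbb.
  have eu' : W^T + diag_mx e \in unitmx.
    by rewrite -unitmx_tr linearD/= trmxK tr_diag_mx addrC.
  by rewrite vE -[u *m _](mulmxK eu') uWE !mul0mx.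
have [f [fs fx fu]] := signs_unitmx xu.
exists e, f; split=> // i qi.
have xi : x 0 i = e 0 i by rewrite mxE (negbTE qi).
by rewrite fx xi.
Qed.

End signs.

(** * Dominant diagonal matrices *)

Section dominant.
Context {R : realType} {n : nat}.
Implicit Types (P A Q W Z U V X Y : 'M[R]_n) (q d e : 'rV[R]_n) (i j : 'I_n).

(** The closed Weyl chamber of type D_n. *)
Definition dominant q := forall i j, (i < j)%N ->
  0 <= q 0 i - q 0 j /\ 0 <= q 0 i + q 0 j.

Definition strictly_dominant q := forall i j, (i < j)%N ->
  0 < q 0 i - q 0 j /\ 0 < q 0 i + q 0 j.

Lemma strictly_dominant_sqr d i j : strictly_dominant d -> i != j ->
  d 0 i ^+ 2 != d 0 j ^+ 2.
Proof.
move=> dd; rewrite -subr_eq0 subr_sqr; have [ij|ji|/val_inj->] := ltngtP i j.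
- by case: (dd _ _ ij) => a b _; rewrite gt_eqF// mulr_gt0.
- case: (dd _ _ ji) => a b _.
  by rewrite -opprB mulNr addrC oppr_eq0 gt_eqF// mulr_gt0 1?addrC.
- by rewrite eqxx.
Qed.

Lemma aligned_dominant Q d : strictly_dominant d -> aligned Q (diag_mx d) ->
  exists2 q, Q = diag_mx q & dominant q.
Proof.
move=> dd QD.
have [q qE] := aligned_diag (fun i j ij => strictly_dominant_sqr dd ij) QD.
exists q => // i j ij; case: (dd _ _ ij) => d1 d2.
have ij' : i != j by rewrite neq_ltn ij.
rewrite qE in QD; have [] := aligned_chamber ij' QD.
by rewrite pmulr_lge0// pmulr_lge0.
Qed.

Lemma nonincreasing_perm_eq (a b : 'I_n -> R) (s : 'S_n) :
  (forall i j, (i < j)%N -> a j <= a i) -> (forall i j, (i < j)%N -> b j <= b i) ->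
  (forall i, b i = a (s i)) -> forall i, b i = a i.
Proof.
move=> aD bD bas.
have sortedD (c : 'I_n -> R) : (forall i j, (i < j)%N -> c j <= c i) ->
    sorted (fun x y : R => y <= x) (map c (enum 'I_n)).
  move=> cD; rewrite sorted_map.
  apply: (@sub_sorted _ (relpre val ltn)) => [x y /= /cD//|].
  by rewrite -sorted_map val_enum_ord iota_ltn_sorted.
suff : map b (enum 'I_n) = map a (enum 'I_n).
  by move=> /eq_in_map eqab i; apply: eqab; rewrite mem_enum.
apply: (sorted_eq (leT := fun x y : R => y <= x)).
- by move=> y x z xy yz; exact: le_trans yz xy.
- by move=> x y /andP[xy yx]; apply/eqP; rewrite eq_le yx xy.
- exact: sortedD.
- exact: sortedD.
have -> : map b (enum 'I_n) = map a (map s (enum 'I_n)).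
  by rewrite -[RHS]map_comp; apply: eq_map => k; exact: bas.
apply: perm_map; apply: uniq_perm; rewrite ?(map_inj_uniq (@perm_inj _ s)) ?enum_uniq//.
move=> k; rewrite mem_enum; apply/mapP; exists (s^-1%g k); rewrite ?mem_enum//.
by rewrite permKV.
Qed.

(** The matrices diag (q ^ 2) and diag (q' ^ 2) are conjugate by Z; a nonzero term
in the expansion of det Z yields a permutation that carries the q_i ^ 2 to the
q'_i ^ 2, and it preserves them since both families are sorted. All the q_i but
the last are nonnegative, and the sign of the last is that of the determinant
unless another q_i vanishes, in which case the last is 0. *)
Lemma dominant_uniq q q' W Z : dominant q -> dominant q' ->
  SO R n W -> SO R n Z -> Z *m diag_mx q *m W = diag_mx q' -> q = q'.
Proof.
move=> qd qd' HW HZ ZQW.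
have sqD (c : 'rV[R]_n) : dominant c -> forall i j, (i < j)%N -> c 0 j ^+ 2 <= c 0 i ^+ 2.
  move=> cd i j /cd[c1 c2]; rewrite -subr_ge0 subr_sqr mulr_ge0//.
have ZQ : Z *m (diag_mx q *m diag_mx q) = diag_mx q' *m diag_mx q' *m Z.
  have tr : W^T *m diag_mx q *m Z^T = diag_mx q'.
    by have := congr1 trmx ZQW; rewrite !trmx_mul !tr_diag_mx mulmxA.
  case: HW HZ => [_ W2 _] [Z1 _ _].
  rewrite -{1}ZQW -tr !mulmxA -(mulmxA _ W) W2 mulmx1.
  by rewrite -(mulmxA _ Z^T) Z1 mulmx1.
have [s sZ] : exists s : 'S_n, forall i, Z i (s i) != 0.
  have dZ : \det Z != 0 by rewrite (SO_det1 HZ) oner_eq0.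
  have [s sZ] : exists s : 'S_n, \prod_i Z i (s i) != 0.
    apply: contrapT => nos; move/eqP: dZ; apply.
    rewrite /determinant big1// => s _.
    have [->|ps] := eqVneq (\prod_i Z i (s i)) 0; first by rewrite mulr0.
    by case: nos; exists s.
  by exists s => i; have /prodf_neq0/(_ i isT) := sZ.
have sq i : q' 0 i ^+ 2 = q 0 i ^+ 2.
  apply: (nonincreasing_perm_eq (s := s) (a := fun i => q 0 i ^+ 2)
    (b := fun i => q' 0 i ^+ 2)) => {i} [||i].
  - exact: sqD.
  - exact: sqD.
  have := congr1 (fun M : 'M[R]_n => M i (s i)) ZQ.
  rewrite /= !mulmx_diag mul_mx_diag mul_diag_mx !mxE mulrC => /(mulIf (sZ i)).
  by rewrite -!expr2.
have pr : \prod_i q 0 i = \prod_i q' 0 i.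
  by rewrite -!det_diag -ZQW !det_mulmx (SO_det1 HZ) (SO_det1 HW) mulr1 mul1r.
apply/rowP => i.
have [[j ij]|nlt] := pselect (exists j, (i < j)%N).
  have [a b] := qd _ _ ij; have [a' b'] := qd' _ _ ij.
  by apply/eqP; rewrite -(@eqrXn2 _ 2)// ?sq//; lra.
have [//|qq'] := eqVneq (q 0 i) (q' 0 i).
move: pr; rewrite (bigD1 i)//= [RHS](bigD1 i)//=.
have eqk k : k != i -> q 0 k = q' 0 k.
  move=> ki; have {ki} ki : (k < i)%N.
    rewrite ltn_neqAle ki leqNgt; apply/negP => ik.
    by apply: nlt; exists k.
  have [a b] := qd _ _ ki; have [a' b'] := qd' _ _ ki.
  by apply/eqP; rewrite -(@eqrXn2 _ 2)// ?sq//; lra.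
rewrite -(eq_bigr _ eqk) => pr.
have [/eqP p0|p0] := eqVneq (\prod_(k | k != i) q 0 k) 0; last first.
  exact: (mulIf p0 pr).
have [k ki qk] : exists2 k, k != i & q 0 k = 0.
  by have /prodf_eq0[k ki /eqP] := p0; exists k.
have {}ki : (k < i)%N.
  rewrite ltn_neqAle ki leqNgt; apply/negP => ik.
  by apply: nlt; exists k.
have [a b] := qd _ _ ki.
have qi : q 0 i = 0 by rewrite qk in a b; lra.
have /eqP := sq i; rewrite qi expr0n/= sqrf_eq0 => /eqP->.
by [].
Qed.

End dominant.

(** * Paths in the stabilizer of a diagonal matrix *)

Section path.
Context {R : realType} {n : nat}.
Implicit Types (P A B Q W Z U V X Y D : 'M[R]_n) (q d e f : 'rV[R]_n) (i j : 'I_n).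

Lemma continuous_cayley X : X^T = - X -> continuous (fun t : R => cayley (t *: X)).
Proof.
move=> Xs; rewrite cayley.unlock.
have idc : continuous (@id R) by move=> ?; exact: cvg_id.
have lin (s : R) : continuous (fun t : R => 1%:M + (s * t) *: X).
  apply: continuous_mx => i j; under eq_fun do rewrite !mxE.
  move=> t; apply: cvgD; first exact: cst_continuous.
  apply: continuous_mul; last exact: cst_continuous.
  by apply: continuous_mul; [move=> ?; exact: cst_continuous|exact: idc].
apply: continuous_mulmx.
  by under eq_fun do rewrite -scaleNr -mulN1r; exact: lin.
apply: continuous_invmx => [|t].
  by under eq_fun do rewrite -[X in X *: _]mul1r; exact: lin.
by apply: unitmx_skew; rewrite linearZ/= Xs scalerN.
Qed.

(** The factor cayley (t J) ^ 2 of h runs from 1 to E F and fixes Q: the product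
E F is -1 on an even set S of coordinates where q vanishes, and J is a quarter
turn of their span. *)
Lemma stabilizer_path q d W Z : SO R n W -> SO R n Z ->
  Z *m diag_mx q *m W = diag_mx q ->
  exists g h : R -> 'M[R]_n,
    [/\ continuous g /\ continuous h,
        forall t, [/\ SO R n (g t), SO R n (h t) & h t *m diag_mx q *m g t = diag_mx q],
        g 0 *m diag_mx d *m h 0 = diag_mx d
      & g 1 *m diag_mx d *m h 1 = W *m diag_mx d *m Z].
Proof.
move=> HW HZ ZQW; have [e [f [es fs fe eu fu]]] := signs_stabilizer HW HZ ZQW.
have EE := signs_sq es; have FF := signs_sq fs.
set E := diag_mx e in eu EE; set F := diag_mx f in fu FF.
have Eu : E \in unitmx by have [] := mulmx1_unit EE.
have Fu : F \in unitmx by have [] := mulmx1_unit FF.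
have ET : E^T = E by exact: tr_diag_mx.
have FT : F^T = F by exact: tr_diag_mx.
have [Xs cX] : (cayley (W *m E))^T = - cayley (W *m E)
    /\ cayley (cayley (W *m E)) = W *m E.
  apply: cayley_ortho; last by rewrite -EE -mulmxDl unitmx_mul eu.
  by rewrite trmx_mul ET mulmxA -(mulmxA E) (let: And3 W1 _ _ := HW in W1) mulmx1.
have [Ys cY] : (cayley (F *m Z))^T = - cayley (F *m Z)
    /\ cayley (cayley (F *m Z)) = F *m Z.
  apply: cayley_ortho; last by rewrite -FF -mulmxDr unitmx_mul fu andbT.
  by rewrite trmx_mul FT mulmxA -(mulmxA Z^T) FF mulmx1; case: HZ.
have YX : cayley (F *m Z) *m diag_mx q + diag_mx q *m cayley (W *m E) = 0.
  apply: intertwine_cayley.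
  - by rewrite -EE -mulmxDl unitmx_mul eu.
  - by rewrite -FF -mulmxDr unitmx_mul fu andbT.
  have -> : F *m Z *m diag_mx q *m (W *m E) = F *m (Z *m diag_mx q *m W) *m E.
    by rewrite !mulmxA.
  rewrite ZQW !mulmx_diag; congr diag_mx; apply/rowP => i; rewrite !mxE.
  have [->|/fe->] := eqVneq (q 0 i) 0; first by rewrite mulr0 mul0r.
  by rewrite mulrAC -expr2 es mul1r.
move: Xs cX Ys cY YX.
(* from here on, only the relations between the skew matrices X and Y matter *)
move: (cayley (W *m E)) (cayley (F *m Z)) => X Y Xs cX Ys cY YX.
pose S := [set i | e 0 i != f 0 i]%SET.
have eS i : e 0 i * f 0 i = (-1) ^+ (i \in S).
  rewrite inE; case: (signsP i es) => ->; case: (signsP i fs) => ->.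
  - by rewrite eqxx mulr1.
  - by rewrite gt_eqF ?mul1r//; lra.
  - by rewrite lt_eqF ?mulr1//; lra.
  - by rewrite eqxx mulrNN mulr1.
have Seven : ~~ odd #|S|.
  have : \det (E *m F) = 1.
    rewrite -[LHS]mul1r -[X in X * _](SO_det1 HW) -[LHS]mulr1 -[X in _ * X = _](SO_det1 HZ).
    rewrite -!det_mulmx mulmxA -mulmxA -cX -cY det_mulmx.
    by rewrite (SO_det1 (cayley_SO Xs)) (SO_det1 (cayley_SO Ys)) mulr1.
  rewrite mulmx_diag det_diag (eq_bigr (fun i => (-1) ^+ (i \in S))) => [|i _]; last first.
    by rewrite mxE eS.
  have Scard : (\sum_i (i \in S) = #|S|)%N.
    by rewrite -sum1_card [RHS]big_mkcond; apply: eq_bigr => i _; case: (i \in S).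
  rewrite prodrXr Scard -signr_odd; case: odd => //.
  by rewrite expr1; lra.
have [J cJ] := complex_structure_even (R := R) Seven.
have JP := complex_structureC cJ; case: cJ => Js J2 PJ.
have JQ : J *m diag_mx q = 0.
  rewrite -JP -mulmxA mulmx_diag.
  have -> : (\row_i ((\row_k (k \in S)%:R) 0 i * q 0 i)) = 0.
    apply/rowP => i; rewrite !mxE inE.
    by have [->|/fe->] := eqVneq (q 0 i) 0; rewrite ?mulr0// eqxx mul0r.
  by rewrite linear0 mulmx0.
have JJ : cayley J *m cayley J = E *m F.
  have PP : coord_proj S *m coord_proj S = coord_proj S :> 'M[R]_n.
    by apply: oppr_inj; rewrite -mulmxN -J2 mulmxA PJ J2.
  have -> : cayley J = 1%:M - coord_proj S - J.
    rewrite -[in LHS](scale1r J) (cayley_complex_structure _ Js J2 PJ) expr1n mulr1.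
    by rewrite divff ?scale1r// gt_eqF//; lra.
  rewrite 2!mulmxBr mulmx1 !mulmxBl !mul1mx PP JP PJ J2 mulmx_diag.
  apply/matrixP => a b; rewrite !mxE eS; have [->|ab] := eqVneq a b; last first.
    by rewrite !mulr0n; ring.
  by case: (b \in S) => /=; ring.
exists (fun t => cayley (t *: X)),
  (fun t => cayley (t *: J) *m cayley (t *: J) *m cayley (t *: Y)).
have sk (t : R) (K : 'M[R]_n) : K^T = - K -> (t *: K)^T = - (t *: K).
  by move=> Ks; rewrite linearZ/= Ks scalerN.
split.
- split; first exact: continuous_cayley.
  apply: continuous_mulmx; last exact: continuous_cayley.
  by apply: continuous_mulmx; exact: continuous_cayley.
- move=> t; split.
  + exact/cayley_SO/sk.
  + by apply: SO_mul; [apply: SO_mul|]; exact/cayley_SO/sk.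
  have YXt : cayley (t *: Y) *m diag_mx q *m cayley (t *: X) = diag_mx q.
    apply: cayley_intertwine; try exact/unitmx_skew/sk.
    by rewrite -scalemxAl -scalemxAr -scalerDr YX scaler0.
  have Jt : cayley (t *: J) *m diag_mx q = diag_mx q.
    rewrite -[LHS]mulmx1 -cayley0; apply: cayley_intertwine.
    - by rewrite addr0 unitmx1.
    - exact/unitmx_skew/sk.
    by rewrite -scalemxAl JQ scaler0 mulmx0 addr0.
  by rewrite -!mulmxA (mulmxA _ (diag_mx q)) YXt !mulmxA -mulmxA Jt Jt.
- by rewrite !scale0r cayley0 !mul1mx !mulmx1.
- rewrite !scale1r cX cY JJ -!mulmxA (mulmxA F) FF mul1mx; congr (_ *m _).
  by rewrite mulmxA diag_mxC -mulmxA (mulmxA E) EE mul1mx.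
Qed.

End path.

(** * Singular value decomposition in the special orthogonal group *)

Section svd.
Context {R : realType} {n : nat}.
Implicit Types (A B U V : 'M[R]_n) (d : 'rV[R]_n) (i j : 'I_n).

(** A maximum point on O(A) of a linear form given by a strictly dominant diagonal
matrix is aligned with it, hence diagonal and dominant. *)
Lemma dominant_svd A : exists U V d,
  [/\ SO R n U, SO R n V, dominant d & A = U *m diag_mx d *m V].
Proof.
pose p : 'rV[R]_n := \row_i (n - i)%:R.
have pd : strictly_dominant p.
  move=> i j ij; rewrite !mxE subr_gt0 ltr_nat ltn_sub2l//; split=> //.
  by rewrite -natrD ltr0n addn_gt0 subn_gt0 ltn_ord.
have cont : continuous (fun B => \tr (diag_mx p *m B)).
  apply: continuous_sum => i; apply: continuous_entry.
  apply: continuous_mulmx; first by move=> ?; exact: cst_continuous.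
  by move=> ?; exact: cvg_id.
have A0 : SO_orbit A !=set0.
  exists (1%:M *m A *m 1%:M); exists 1%:M; first exact: SO_id.
  by exists 1%:M; first exact: SO_id.
have [B] := compact_EVT_max A0 (@compact_SO_orbit R n A) (continuous_subspaceT cont).
move=> /set_mem [U HU [V HV BE]] Bmax.
have PB : aligned (diag_mx p) B.
  move=> U' V' HU' HV'; apply: Bmax; apply: mem_set.
  exists (U' *m U); first exact: SO_mul.
  by exists (V *m V'); [exact: SO_mul|rewrite -BE !mulmxA].
have [d dE dd] := aligned_dominant pd (alignedC PB).
exists U^T, V^T, d; split=> //; try exact: SO_tr.
case: HU HV => [U1 _ _] [_ V2 _].
by rewrite -dE -BE !mulmxA U1 mul1mx -mulmxA V2 mulmx1.
Qed.

(** The singular values are among the |d_i|, so if two of these coincide there are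
at most n - 1 singular values. *)
Lemma dominant_singular_values U V d :
  SO R n U -> SO R n V -> dominant d ->
  (singular_values (U *m diag_mx d *m V) #= `I_n)%card -> strictly_dominant d.
Proof.
move=> [U1 U2 _] [V1 V2 _] dd card; set A := U *m _ *m V in card.
have sub s : singular_values A s -> exists k, s = `|d 0 k|.
  case=> a /= /eigenvalueP[v vA v0] <-.
  have : (v *m V^T) *m (diag_mx d *m diag_mx d) = a *: (v *m V^T).
    rewrite scalemxAl -vA /A !trmx_mul tr_diag_mx !mulmxA.
    rewrite -[RHS](mulmxA _ V V^T) V2 mulmx1; congr (_ *m _).
    by rewrite -(mulmxA _ U^T U) U1 mulmx1.
  move: (v *m V^T) (mulmxK (mulmx1_unit V2).2 v) => w wv.
  have w0 : w != 0 by apply: contraNneq v0 => w0; rewrite -wv w0 mul0mx.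
  have [k wk] : exists k, w 0 k != 0 by exact/rV0Pn.
  rewrite mulmx_diag mul_mx_diag => /rowP /(_ k); rewrite !mxE mulrC => /(mulIf wk) <-.
  by exists k; rewrite -expr2 sqrtr_sqr.
have fin : finite_set (singular_values A) by exists n.
have dinj i j : i != j -> `|d 0 i| != `|d 0 j|.
  move=> ij; apply/eqP => dij.
  pose s : seq R := [seq `|d 0 k| | k <- enum (predC1 j)].
  suff : (size (finmap.enum_fset (fset_set (singular_values A))) <= size s)%N.
    rewrite [size _](card_fset_set card) size_map -cardE cardC1 card_ord.
    by rewrite -ltnS prednK ?ltnn// (leq_ltn_trans (leq0n j) (ltn_ord j)).
  apply: uniq_leq_size => [|a]; first exact: finmap.fset_uniq.
  rewrite in_fset_set// => /set_mem /sub[k ->]; apply/mapP.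
  have [->|kj] := eqVneq k j; first by exists i; rewrite // mem_enum.
  by exists k; rewrite // mem_enum.
move=> i j ij; have [a b] := dd _ _ ij.
have ij' : i != j by rewrite neq_ltn ij.
have := dinj _ _ ij'.
have -> : `|d 0 i| = d 0 i by rewrite ger0_norm//; lra.
move=> dij; rewrite !lt_neqAle a b !andbT; split.
  apply: contraNneq dij => e; apply/eqP.
  by rewrite ger0_norm; lra.
apply: contraNneq dij => e; apply/eqP.
by rewrite ler0_norm; lra.
Qed.

End svd.

(** * Faces of the orbit *)

Lemma path_connected_image (R : realType) (T U : topologicalType) (f : T -> U)
    (S : set T) : continuous f -> path_connected R S -> path_connected R (f @` S).
Proof.
move=> fc Sc _ _ [x Sx <-] [y Sy <-]; have [g [gc g0 g1 gS]] := Sc x y Sx Sy.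
exists (f \o g); split=> /=; rewrite ?g0 ?g1//.
  by move=> t; exact: (continuous_comp (gc t) (fc _)).
by move=> _ [t t01 <-]; exists (g t) => //; apply: gS; exists t.
Qed.

Section faces.
Context {R : realType} {n : nat}.
Implicit Types (P A B Q W Z U V X Y D : 'M[R]_n) (q d e f : 'rV[R]_n) (i j : 'I_n).

(** The matrices Q = V P U for the points U D V of the face are all equal, so that any
two points of the face differ by a pair stabilizing Q. *)
Lemma SO_orbit_face_path_connected P d (r : R) : strictly_dominant d ->
  ubound [set \tr (P *m B) | B in SO_orbit (diag_mx d)] r ->
  path_connected R (SO_orbit (diag_mx d) `&` [set B | \tr (P *m B) = r]).
Proof.
move=> dd rmax _ _ [[U HU [V HV <-]] /= trB] [[U' HU' [V' HV' <-]] /= trB'].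
have al U1 V1 : SO R n U1 -> SO R n V1 -> \tr (P *m (U1 *m diag_mx d *m V1)) = r ->
    aligned (V1 *m P *m U1) (diag_mx d).
  move=> HU1 HV1 tr1 U2 V2 HU2 HV2.
  have cyc X : \tr (V1 *m P *m U1 *m X) = \tr (P *m (U1 *m X *m V1)).
    by rewrite -2!mulmxA mxtrace_mulC !mulmxA.
  rewrite !cyc tr1; apply: rmax; exists (U1 *m U2 *m diag_mx d *m (V2 *m V1)).
    by exists (U1 *m U2); [exact: SO_mul|exists (V2 *m V1); [exact: SO_mul|]].
  by rewrite !mulmxA.
have [q qE qd] := aligned_dominant dd (al _ _ HU HV trB).
have [q' q'E qd'] := aligned_dominant dd (al _ _ HU' HV' trB').
pose W := U^T *m U'; pose Z := V' *m V^T.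
have HW : SO R n W by apply: SO_mul => //; exact: SO_tr.
have HZ : SO R n Z by apply: SO_mul => //; exact: SO_tr.
have UW : U *m W = U' by case: HU => _ U2 _; rewrite mulmxA U2 mul1mx.
have ZV : Z *m V = V' by case: HV => V1 _ _; rewrite -mulmxA V1 mulmx1.
have ZQW : Z *m diag_mx q *m W = diag_mx q' by rewrite -qE -q'E -UW -ZV !mulmxA.
have qq' := dominant_uniq qd qd' HW HZ ZQW; rewrite -qq' in ZQW.
have [g [h [[gc hc] gh D0 D1]]] := stabilizer_path d HW HZ ZQW.
exists (fun t => U *m (g t *m diag_mx d *m h t) *m V); split.
- apply: continuous_subspaceT.
  have cc (C : 'M[R]_n) : continuous (fun _ : R => C) by move=> ?; exact: cst_continuous.
  apply: continuous_mulmx => //; apply: continuous_mulmx => //.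
  by apply: continuous_mulmx => //; exact: continuous_mulmx.
- by rewrite D0.
- by rewrite D1 -UW -ZV !mulmxA.
move=> _ [t _ <-]; have [Hg Hh hqg] := gh t; split.
  exists (U *m g t); first exact: SO_mul.
  by exists (h t *m V); [exact: SO_mul|rewrite !mulmxA].
rewrite /= -trB.
have cyc X : \tr (P *m (U *m X *m V)) = \tr (diag_mx q *m X).
  by rewrite -qE -[in RHS]mulmxA -[in RHS]mulmxA [RHS]mxtrace_mulC !mulmxA.
by rewrite !cyc -[in RHS]hqg mulmxA [LHS]mxtrace_mulC !mulmxA.
Qed.

Lemma dir_form_trace (theta : R) (L : {linear 'M[R]_n -> 'rV[R]_2}) :
  exists P, forall B, dir_form theta (L B) = \tr (P *m B).
Proof.
exists (\matrix_(i, j) dir_form theta (L (delta_mx j i))) => B.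
have LE c : L B 0 c = \sum_i \sum_k B k i * L (delta_mx k i) 0 c.
  rewrite [in LHS](matrix_sum_delta B) linear_sum summxE exchange_big/=.
  apply: eq_bigr => k _; rewrite linear_sum summxE; apply: eq_bigr => i _.
  by rewrite linearZ mxE.
rewrite /dir_form !LE !mulr_sumr -big_split; apply: eq_bigr => i _.
rewrite !mulr_sumr -big_split mxE; apply: eq_bigr => k _.
by rewrite !mxE /dir_form /=; ring.
Qed.

Lemma SO_orbit_mul U V D : SO R n U -> SO R n V ->
  SO_orbit (U *m D *m V) = SO_orbit D.
Proof.
move=> HU HV; apply/seteqP; split=> _ [U1 HU1 [V1 HV1 <-]].
  exists (U1 *m U); first exact: SO_mul.
  by exists (V *m V1); [exact: SO_mul|rewrite !mulmxA].
exists (U1 *m U^T); first by apply: SO_mul => //; exact: SO_tr.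
exists (V^T *m V1); first by apply: SO_mul => //; exact: SO_tr.
case: HU HV => [U2 _ _] [_ V2 _].
by rewrite -!mulmxA (mulmxA U^T) U2 mul1mx (mulmxA V) V2 mul1mx.
Qed.

End faces.

Theorem corollary3p5 (R : realType) (n : nat) (A : 'M[R]_n)
  (hA : (singular_values A #= `I_n)%card)
  (L : {linear 'M[R]_n -> 'rV[R]_2}) :
  has_convex_boundary (L @` SO_orbit A).
Proof.
have Lc : continuous L by exact: continuous_linear_mx.
split.
  apply: continuous_compact; last exact: compact_SO_orbit.
  exact: continuous_subspaceT.
move=> _ [theta [r [_ [_ rmax] ->]]].
have [U [V [d [HU HV dd AE]]]] := dominant_svd A.
have sd : strictly_dominant d.
  by apply: (dominant_singular_values HU HV dd); rewrite -AE.
have orbE : SO_orbit A = SO_orbit (diag_mx d) by rewrite AE SO_orbit_mul.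
rewrite orbE in rmax *.
have [P PE] := dir_form_trace theta L.
have face : path_connected R (SO_orbit (diag_mx d) `&` [set B | \tr (P *m B) = r]).
  apply: SO_orbit_face_path_connected => // _ [B HB <-].
  by rewrite -PE; apply: rmax; exists (L B) => //; exists B.
have -> : L @` SO_orbit (diag_mx d) `&` [set p | dir_form theta p = r] =
    L @` (SO_orbit (diag_mx d) `&` [set B | \tr (P *m B) = r]).
  apply/seteqP; split=> [_ [[B HB <-] /= Br]|_ [B [HB /= Br] <-]].
    by exists B => //; split; rewrite //= -PE.
  by split; [exists B|rewrite /= PE].
exact: path_connected_image.
Qed.
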